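(* Let $N\geq 1$, let $A\in M_N(\mathbb{C})$ and let $0<\epsilon<1$. Then for every $z\in\mathbb{C}$, $$\|(z-A)^{-1}\|\geq \frac{1}{d(z,\sigma_\epsilon(A))+\frac{2\epsilon}{1-\epsilon}\|A\|},$$ where the left-hand side is interpreted as $\infty$ when $z-A$ is not invertible (and the right-hand side is interpreted as $\infty$ if its denominator is $0$).
   Context: $M_N(\mathbb{C})$ is the algebra of complex $N\times N$ matrices; $\|\cdot\|$ is the Euclidean norm on $\mathbb{C}^N$ and the induced operator norm (spectral norm) on $M_N(\mathbb{C})$. For a scalar $z$, $z-A$ means $zI-A$. For $0<\epsilon<1$ the $\epsilon$-condition spectrum of $A$ is $$\sigma_\epsilon(A)=\{z\in\mathbb{C}: z-A \text{ is not invertible, or } \|(z-A)^{-1}\|\,\|z-A\|\geq 1/\epsilon\}.$$ For $S\subseteq\mathbb{C}$ nonempty, $d(z,S)=\inf_{w\in S}|z-w|$. *)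

(* Defs.v *)
From HB Require Import structures.
From mathcomp Require Import all_boot all_order all_algebra.
From mathcomp Require Import classical_sets reals constructive_ereal complex.
Import ComplexField.Normc.

Set Implicit Arguments.
Unset Strict Implicit.
Unset Printing Implicit Defensive.

Import Order.TTheory GRing.Theory Num.Theory.

Local Open Scope classical_set_scope.
Local Open Scope ring_scope.

(* [normc] is the real-valued modulus on [R[i]], whereas [`|z|] lives in [R[i]]. *)
Definition euclidean_norm (R : realType) (N : nat) (v : 'cV[R[i]]_N) : R :=
  Num.sqrt (\sum_(i < N) normc (v i 0) ^+ 2).

(* The set is nonempty (it contains 0) and bounded above by the Frobenius norm
   of A, so the real-valued [sup] is a genuine supremum. *)
Definition spectral_norm (R : realType) (N : nat) (A : 'M[R[i]]_N) : R :=
  sup [set euclidean_norm (A *m v) | v in [set v | euclidean_norm v <= 1]].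

(* ||(z - A)^-1||, with value +oo when z - A is singular; the case split is
   needed because [invmx] returns its argument on singular matrices. *)
Definition resolvent_norm (R : realType) (N : nat) (A : 'M[R[i]]_N)
    (z : R[i]) : \bar R :=
  if z%:M - A \in unitmx then (spectral_norm (invmx (z%:M - A)))%:E else +oo%E.

Definition condition_spectrum (R : realType) (N : nat) (e : R)
    (A : 'M[R[i]]_N) : set R[i] :=
  [set z | z%:M - A \notin unitmx \/
     spectral_norm (invmx (z%:M - A)) * spectral_norm (z%:M - A) >= 1 / e].

(* Meaningful for nonempty S only: [inf set0 = 0]. *)
Definition dist_to (R : realType) (z : R[i]) (S : set R[i]) : R :=
  inf [set normc (z - w) | w in S].

(* Main.v *)
Require Import Defs.
From mathcomp Require Import all_boot all_order all_algebra.
From mathcomp Require Import classical_sets reals constructive_ereal complex.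
From mathcomp Require Import lra.

(* With [s = 1 / ||(z - A)^-1||], the operator [z - A] expands every vector by
   at least [s], so [w - A] expands every vector by at least [s - |z - w|].
   If [w - A] is singular this forces [s <= |z - w|].  If its condition number
   is at least [1 / e] it forces [s - |z - w| <= e ||w - A||]; applying the same
   principle to the expansion factor [|w| - ||A||] of [w - A] bounds [|w|], and
   hence [||w - A||] by [2 ||A|| / (1 - e)]. *)

Import ComplexField.Normc.
Import Order.TTheory GRing.Theory Num.Theory.

Set Implicit Arguments.
Unset Strict Implicit.
Unset Printing Implicit Defensive.

Local Open Scope classical_set_scope.
Local Open Scope ring_scope.

Section EuclideanNorm.
Context {R : realType}.

Lemma normc_ge0 (x : R[i]) : 0 <= normc x.
Proof. by case: x => a b; exact: sqrtr_ge0. Qed.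

Context {N : nat}.
Implicit Types (u v : 'cV[R[i]]_N) (k : R[i]).

Lemma sum_normc_sqr_ge0 v : 0 <= \sum_(i < N) normc (v i 0) ^+ 2.
Proof. by apply: sumr_ge0 => i _; exact: sqr_ge0. Qed.

Lemma euclidean_norm_ge0 v : 0 <= euclidean_norm v.
Proof. exact: sqrtr_ge0. Qed.

Lemma sqr_euclidean_norm v :
  euclidean_norm v ^+ 2 = \sum_(i < N) normc (v i 0) ^+ 2.
Proof. by rewrite sqr_sqrtr ?sum_normc_sqr_ge0. Qed.

Lemma euclidean_norm0 : euclidean_norm (0 : 'cV[R[i]]_N) = 0.
Proof.
apply/eqP; rewrite -sqrf_eq0 sqr_euclidean_norm big1// => i _.
by rewrite mxE normc0 expr0n.
Qed.

Lemma normc_le_euclidean_norm v i : normc (v i 0) <= euclidean_norm v.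
Proof.
rewrite -(ler_pXn2r (ltn0Sn 1)) ?nnegrE ?normc_ge0 ?euclidean_norm_ge0//.
rewrite sqr_euclidean_norm (bigD1 i)//= lerDl.
by apply: sumr_ge0 => j _; exact: sqr_ge0.
Qed.

Lemma euclidean_norm_eq0 v : (euclidean_norm v == 0) = (v == 0).
Proof.
apply/eqP/eqP => [v0|->]; last exact: euclidean_norm0.
apply/matrixP => i j; rewrite ord1 mxE; apply: eq0_normc.
by apply/eqP; rewrite eq_le normc_ge0 -{1}v0 normc_le_euclidean_norm.
Qed.

Lemma euclidean_normZ k v :
  euclidean_norm (k *: v) = normc k * euclidean_norm v.
Proof.
apply/eqP; rewrite -(eqrXn2 (ltn0Sn 1)) ?mulr_ge0 ?normc_ge0 ?euclidean_norm_ge0//.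
rewrite exprMn !sqr_euclidean_norm mulr_sumr; apply/eqP/eq_bigr => i _.
by rewrite mxE normcM exprMn.
Qed.

Lemma euclidean_normN v : euclidean_norm (- v) = euclidean_norm v.
Proof.
by rewrite /euclidean_norm; congr Num.sqrt; apply: eq_bigr => i _; rewrite mxE normcN.
Qed.

(** Convexity of the square with weights [a] and [b] replaces the Cauchy-Schwarz inequality. The
    weights must be positive, so zero vectors are treated first. *)
Lemma euclidean_normD u v :
  euclidean_norm (u + v) <= euclidean_norm u + euclidean_norm v.
Proof.
have [u0|u0] := eqVneq u 0; first by rewrite u0 add0r euclidean_norm0 add0r.
have [v0|v0] := eqVneq v 0; first by rewrite v0 addr0 euclidean_norm0 addr0.
rewrite -(ler_pXn2r (ltn0Sn 1)) ?nnegrE ?addr_ge0 ?euclidean_norm_ge0//.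
set a := euclidean_norm u; set b := euclidean_norm v.
have a_gt0 : 0 < a by rewrite lt_def euclidean_norm_eq0 u0 euclidean_norm_ge0.
have b_gt0 : 0 < b by rewrite lt_def euclidean_norm_eq0 v0 euclidean_norm_ge0.
have ab_gt0 : 0 < a * b by rewrite mulr_gt0.
(* Sum over the coordinates of ab (x + y)^2 <= b (a + b) x^2 + a (a + b) y^2,
   whose two sides differ by (b x - a y)^2. *)
rewrite -(ler_pM2l ab_gt0).
have -> : a * b * (a + b) ^+ 2
    = b * (a + b) * a ^+ 2 + a * (a + b) * b ^+ 2 by lra.
rewrite !sqr_euclidean_norm !mulr_sumr -big_split/=; apply: ler_sum => i _.
set x := normc (u i 0); set y := normc (v i 0); rewrite mxE.
have xy : normc (u i 0 + v i 0) ^+ 2 <= (x + y) ^+ 2.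
  by rewrite ler_pXn2r ?nnegrE ?addr_ge0 ?normc_ge0// le_normcD.
apply: le_trans (ler_wpM2l (ltW ab_gt0) xy) _.
by have := sqr_ge0 (b * x - a * y); lra.
Qed.

Lemma euclidean_normB u v :
  euclidean_norm u - euclidean_norm v <= euclidean_norm (u - v).
Proof. by rewrite lerBlDr -{1}(subrK v u) euclidean_normD. Qed.

End EuclideanNorm.

Section SpectralNorm.
Context {R : realType} {N : nat}.
Implicit Types (A B : 'M[R[i]]_N) (v : 'cV[R[i]]_N) (z w : R[i]).

Lemma normc_sum (I : Type) (r : seq I) (F : I -> R[i]) :
  normc (\sum_(i <- r) F i) <= \sum_(i <- r) normc (F i).
Proof.
elim/big_ind2 : _ => [|x a y b xa yb|//]; first by rewrite normc0.
by rewrite (le_trans (le_normcD _ _))// lerD.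
Qed.

Lemma spectral_norm_has_ubound A :
  has_ubound [set euclidean_norm (A *m v) | v in [set v | euclidean_norm v <= 1]].
Proof.
(* Each coordinate of [v] has modulus at most 1, so entry [i] of [A *m v] is bounded by the l1-norm
   of row [i]. *)
exists (Num.sqrt (\sum_(i < N) (\sum_(j < N) normc (A i j)) ^+ 2)) => _ [v v1 <-].
rewrite ler_wsqrtr//; apply: ler_sum => i _; rewrite mxE.
rewrite ler_pXn2r ?nnegrE ?normc_ge0 ?sumr_ge0//; last first.
  by move=> j _; exact: normc_ge0.
apply: le_trans (normc_sum _ _) _; apply: ler_sum => j _.
rewrite normcM ler_piMr ?normc_ge0//.
exact: le_trans (normc_le_euclidean_norm v j) v1.
Qed.

Lemma spectral_norm_ge0 A : 0 <= spectral_norm A.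
Proof.
apply: ub_le_sup; first exact: spectral_norm_has_ubound.
by exists 0; rewrite /= ?mulmx0 euclidean_norm0 ?ler01.
Qed.

Lemma spectral_norm_le A (k : R) : 0 <= k ->
  (forall v, euclidean_norm (A *m v) <= k * euclidean_norm v) ->
  spectral_norm A <= k.
Proof.
move=> k0 Ak; apply: ge_sup.
  by exists 0, 0; rewrite /= ?mulmx0 euclidean_norm0 ?ler01.
move=> _ [v v1 <-]; apply: le_trans (Ak v) _.
by rewrite ler_piMr.
Qed.

Lemma euclidean_norm_mulmx A v :
  euclidean_norm (A *m v) <= spectral_norm A * euclidean_norm v.
Proof.
have [->|v0] := eqVneq v 0; first by rewrite mulmx0 euclidean_norm0 mulr0.
have nv_gt0 : 0 < euclidean_norm v.
  by rewrite lt_def euclidean_norm_eq0 v0 euclidean_norm_ge0.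
(* Rescaling by [c] puts [v] on the unit sphere, inside the set whose [sup] is taken. *)
pose c : R[i] := ((euclidean_norm v)^-1)%:C%C.
have normc_c : normc c = (euclidean_norm v)^-1.
  by rewrite /c /= expr0n addr0 sqrtr_sqr ger0_norm// invr_ge0 ltW.
rewrite -ler_pdivrMr// mulrC -normc_c -euclidean_normZ scalemxAr.
apply: ub_le_sup; first exact: spectral_norm_has_ubound.
by exists (c *: v) => //=; rewrite euclidean_normZ normc_c mulVf// gt_eqF.
Qed.

Lemma spectral_norm_scalar_sub w A :
  spectral_norm (w%:M - A) <= normc w + spectral_norm A.
Proof.
apply: spectral_norm_le => [|v]; first by rewrite addr_ge0 ?normc_ge0 ?spectral_norm_ge0.
rewrite mulmxBl mul_scalar_mx (le_trans (euclidean_normD _ _))//.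
by rewrite euclidean_normN euclidean_normZ mulrDl lerD2l euclidean_norm_mulmx.
Qed.

(** Reverse triangle inequality; the factor may be negative. It later serves to bound [normc w] on
    the condition spectrum. *)
Lemma scalar_sub_expansion w A v :
  (normc w - spectral_norm A) * euclidean_norm v
    <= euclidean_norm ((w%:M - A) *m v).
Proof.
rewrite mulmxBl mul_scalar_mx (le_trans _ (euclidean_normB _ _))//.
by rewrite euclidean_normZ mulrBl lerD2l lerN2 euclidean_norm_mulmx.
Qed.

(** An inverse of norm 0 would kill [B *m v] for a nonzero [v], and such a [v] exists because
    [0 < N]. *)
Lemma spectral_norm_invmx_gt0 B : (0 < N)%N -> B \in unitmx ->
  0 < spectral_norm (invmx B).
Proof.
move=> N0 uB; rewrite lt_def spectral_norm_ge0 andbT; apply/eqP => inv0.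
have v0 : const_mx 1 != 0 :> 'cV[R[i]]_N.
  apply/eqP => /matrixP /(_ (Ordinal N0) 0); rewrite !mxE; exact/eqP/oner_neq0.
have := euclidean_norm_mulmx (invmx B) (B *m const_mx 1).
rewrite mulKmx// inv0 mul0r le_eqVlt euclidean_norm_eq0 (negPf v0)/=.
by rewrite ltNge euclidean_norm_ge0.
Qed.

Lemma unitmx_expansion B v : (0 < N)%N -> B \in unitmx ->
  (spectral_norm (invmx B))^-1 * euclidean_norm v <= euclidean_norm (B *m v).
Proof.
move=> N0 uB; rewrite mulrC ler_pdivrMr ?spectral_norm_invmx_gt0// mulrC.
by have := euclidean_norm_mulmx (invmx B) (B *m v); rewrite mulKmx.
Qed.

Lemma singular_expansion_le0 B (k : R) : B \notin unitmx ->
  (forall v, k * euclidean_norm v <= euclidean_norm (B *m v)) -> k <= 0.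
Proof.
(* [det0P] yields a row vector in the left kernel; passing to the transpose makes it a column in the
   kernel of [B]. *)
rewrite unitmxE unitfE negbK -det_tr => /det0P [u u0 uB] Bk.
have ut0 : u^T != 0 by rewrite trmx_eq0.
have Bu : B *m u^T = 0 by rewrite -[B]trmxK -trmx_mul uB trmx0.
have := Bk u^T; rewrite Bu euclidean_norm0 pmulr_lle0//.
by rewrite lt_def euclidean_norm_eq0 ut0 euclidean_norm_ge0.
Qed.

(** For [k > 0], expansion by [k] bounds the norm of the inverse by [k^-1], so the condition number
    is at most [spectral_norm B / k]. *)
Lemma condition_number_expansion_le B (e k : R) : 0 < e -> B \in unitmx ->
  1 / e <= spectral_norm (invmx B) * spectral_norm B ->
  (forall v, k * euclidean_norm v <= euclidean_norm (B *m v)) ->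
  k <= e * spectral_norm B.
Proof.
move=> e0 uB cond Bk; have [k0|k0] := leP k 0.
  by rewrite (le_trans k0)// mulr_ge0 ?spectral_norm_ge0// ltW.
have invk : spectral_norm (invmx B) <= k^-1.
  apply: spectral_norm_le => [|v]; first by rewrite invr_ge0 ltW.
  rewrite mulrC ler_pdivlMr// mulrC.
  by have := Bk (invmx B *m v); rewrite mulKVmx.
have := le_trans cond (ler_wpM2r (spectral_norm_ge0 B) invk).
by rewrite ler_pdivrMr// -mulrA ler_pdivlMl// mulr1 mulrC.
Qed.

Lemma condition_spectrum_expansion_le A (e k : R) w :
  0 < e -> e < 1 -> condition_spectrum e A w ->
  (forall v, k * euclidean_norm v <= euclidean_norm ((w%:M - A) *m v)) ->
  k <= 2 * e / (1 - e) * spectral_norm A.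
Proof.
move=> e0 e1 /= ew wk; have e1_gt0 : 0 < 1 - e by rewrite subr_gt0.
have A0 := spectral_norm_ge0 A.
have [uw|nuw] := boolP (w%:M - A \in unitmx); last first.
  rewrite (le_trans (singular_expansion_le0 nuw wk))// mulr_ge0//.
  by rewrite divr_ge0 ?mulr_ge0// ltW.
have cond : 1 / e <= spectral_norm (invmx (w%:M - A)) * spectral_norm (w%:M - A).
  by case: ew => //; rewrite uw.
have kw := condition_number_expansion_le e0 uw cond wk.
have ww := condition_number_expansion_le e0 uw cond (scalar_sub_expansion w A).
have wA := spectral_norm_scalar_sub w A.
rewrite mulrAC ler_pdivlMr//.
move: (spectral_norm (w%:M - A)) kw ww wA => M kw ww wA.
(* Here [ww] gives |w| <= ||A|| + e M and [wA] gives M <= |w| + ||A||; adding them eliminates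
   |w|. *)
have M_le : M * (1 - e) <= 2 * spectral_norm A by lra.
have := ler_wpM2l (ltW e0) M_le; have := ler_wpM2r (ltW e1_gt0) kw.
by lra.
Qed.

(** Any eigenvalue of [A] belongs to it. This makes the [inf] in [dist_to] a genuine infimum rather
    than a default value. *)
Lemma condition_spectrum_nonempty A (e : R) : (0 < N)%N ->
  condition_spectrum e A !=set0.
Proof.
move=> N0; have /closed_rootP [w rw] : size (char_poly A) != 1%N.
  by rewrite size_char_poly; case: N N0 A.
exists w; left; rewrite unitmxE unitfE negbK.
move: rw; rewrite -eigenvalue_root_char => /eigenvalueP [v vA v0].
by apply/det0P; exists v => //; rewrite mulmxBr mul_mx_scalar vA subrr.
Qed.

Lemma invmx_norm_inv_le_dist A (e : R) z : (0 < N)%N -> 0 < e -> e < 1 ->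
  z%:M - A \in unitmx ->
  (spectral_norm (invmx (z%:M - A)))^-1
    <= dist_to z (condition_spectrum e A) + 2 * e / (1 - e) * spectral_norm A.
Proof.
move=> N0 e0 e1 uz; rewrite -lerBlDr.
apply: lb_le_inf; first exact/image_nonempty/condition_spectrum_nonempty.
move=> _ [w ew <-]; rewrite lerBlDr -lerBlDl.
apply: (condition_spectrum_expansion_le e0 e1 ew) => v.
rewrite mulrBl lerBlDr (le_trans (unitmx_expansion v N0 uz))//.
(* A scalar perturbation by [z - w] costs at most |z - w| in the expansion factor. *)
have -> : z%:M - A = (w%:M - A) + (z - w)%:M.
  by rewrite raddfB/= [RHS]addrC addrA subrK.
by rewrite mulmxDl mul_scalar_mx -euclidean_normZ euclidean_normD.
Qed.

End SpectralNorm.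

Theorem mainTheorem2 (R : realType) (N : nat) (hN : (1 <= N)%N)
    (A : 'M[R[i]]_N) (e : R) (he0 : (0 < e)%R) (he1 : (e < 1)%R) (z : R[i]) :
  (resolvent_norm A z >=
     1 / (dist_to z (condition_spectrum e A)
          + (2 * e) / (1 - e) * spectral_norm A)%R%:E)%E.
Proof.
rewrite /resolvent_norm; case: ifPn => [uz|_]; last exact: leey.
have K0 := spectral_norm_invmx_gt0 hN uz.
have KD := invmx_norm_inv_le_dist hN he0 he1 uz.
(* Positivity keeps the extended-real quotient finite, so it is an ordinary inverse and inverting
   [KD] gives the claim. *)
have D0 : 0 < dist_to z (condition_spectrum e A)
              + 2 * e / (1 - e) * spectral_norm A.
  by rewrite (lt_le_trans _ KD)// invr_gt0.
rewrite mul1e inver gt_eqF// lee_fin -[leRHS]invrK.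
by rewrite lef_pV2// posrE invr_gt0.
Qed.
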